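(* Let $n\ge1$ and $k\ge0$ be integers, let $\mathcal{L}=\sum_{j=1}^n\partial_{z_j}^2$ with $\partial_{z_j}=\partial_{x_j}+i\partial_{y_j}$, and let $$\mathcal{H}_k^{\mathcal{L}}(\mathbb{C}^n)=\{P_k\in\mathcal{P}_k(\mathbb{C}^n):\mathcal{L}P_k=0\}$$ be the space of $k$-homogeneous polynomials in the kernel of $\mathcal{L}$. Then $$\dim\mathcal{H}_k^{\mathcal{L}}(\mathbb{C}^n)=\binom{2n+k-1}{2n-1}-\binom{2n+k-3}{2n-1}\qquad\text{for }k\ge2,$$ and $\dim\mathcal{H}_0^{\mathcal{L}}(\mathbb{C}^n)=1$, $\dim\mathcal{H}_1^{\mathcal{L}}(\mathbb{C}^n)=2n$.
   Context: Here $z_j=x_j+iy_j$, $\overline{z}_j=x_j-iy_j$ for $j=1,\dots,n$, with $(x,y)\in\mathbb{R}^n\times\mathbb{R}^n=\mathbb{R}^{2n}$. $\mathcal{P}_k(\mathbb{C}^n)$ is the complex vector space of $k$-homogeneous polynomials on $\mathbb{R}^{2n}$ in the real variables $x_1,\dots,x_n,y_1,\dots,y_n$ with complex coefficients; equivalently, the complex span of the monomials $z^\alpha\overline{z}^\beta$ with multi-indices $\alpha,\beta\in\mathbb{N}_0^n$, $|\alpha|+|\beta|=k$ (which form a basis). Dimensions are over $\mathbb{C}$. The operators satisfy $\partial_{z_j}z_j=0$ and $\partial_{z_j}\overline{z}_j=2$ (note the absence of the factor $1/2$ and the sign convention). *)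

(* Defs.v *)
From HB Require Import structures.
From mathcomp Require Import all_boot all_order all_algebra.
From mathcomp Require Import complex mpoly.
From mathcomp Require Import reals.

Set Implicit Arguments.
Unset Strict Implicit.
Unset Printing Implicit Defensive.

Import Order.TTheory GRing.Theory Num.Theory.

Local Open Scope ring_scope.

(* Polynomials on R^(2n) are formal polynomials in n + n variables: x_j is the *)
(* variable of index lshift n j and y_j the variable of index rshift n j.      *)
Definition varx (R : realType) (n : nat) (j : 'I_n) : {mpoly R[i][n + n]} :=
  'X_(lshift n j).

Definition vary (R : realType) (n : nat) (j : 'I_n) : {mpoly R[i][n + n]} :=
  'X_(rshift n j).

Definition varz (R : realType) (n : nat) (j : 'I_n) : {mpoly R[i][n + n]} :=
  varx R j + 'i *: vary R j.

Definition varzbar (R : realType) (n : nat) (j : 'I_n) : {mpoly R[i][n + n]} :=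
  varx R j - 'i *: vary R j.

(* No factor 1/2, and a plus sign: dz kills z_j and maps its conjugate to 2. *)
Definition dz (R : realType) (n : nat) (j : 'I_n) (p : {mpoly R[i][n + n]}) :
    {mpoly R[i][n + n]} :=
  p^`M(lshift n j) + 'i *: p^`M(rshift n j).

Lemma dz_is_linear (R : realType) (n : nat) (j : 'I_n) : linear (@dz R n j).
Proof.
move=> c p q; rewrite /dz !linearP /= !scalerDr !scalerA mulrC.
by rewrite addrACA.
Qed.

HB.instance Definition _ (R : realType) (n : nat) (j : 'I_n) :=
  GRing.isLinear.Build R[i] {mpoly R[i][n + n]} {mpoly R[i][n + n]} _
    (@dz R n j) (@dz_is_linear R n j).

Lemma mderiv_var (K : nzRingType) (m : nat) (i j : 'I_m) :
  ('X_i : {mpoly K[m]})^`M(j) = (i == j)%:R.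
Proof.
rewrite mderivX mnm1E; case: eqP => [->|_]; last by rewrite scale0r.
by rewrite -[X in (X - _)%MM]add0m addmK mpolyX0 scale1r.
Qed.

Lemma dz_varx (R : realType) (n : nat) (j l : 'I_n) :
  dz j (varx R l) = (l == j)%:R.
Proof.
by rewrite /dz !mderiv_var eq_lrshift scaler0 addr0 eq_lshift.
Qed.

Lemma dz_vary (R : realType) (n : nat) (j l : 'I_n) :
  dz j (vary R l) = 'i *: (l == j)%:R.
Proof.
by rewrite /dz !mderiv_var eq_rlshift add0r eq_rshift.
Qed.

Lemma dz_varz (R : realType) (n : nat) (j l : 'I_n) : dz j (varz R l) = 0.
Proof.
rewrite linearD linearZ /= dz_varx dz_vary scalerA -expr2 sqrCi.
by rewrite scaleN1r subrr.
Qed.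

Lemma dz_varzbar (R : realType) (n : nat) (j l : 'I_n) :
  dz j (varzbar R l) = 2 *+ (l == j).
Proof.
rewrite linearB linearZ /= dz_varx dz_vary scalerA -expr2 sqrCi.
by rewrite scaleN1r opprK -natrD -mulr_natl; case: eqP; rewrite ?mulr1 ?mul0r.
Qed.

Definition calL (R : realType) (n : nat) (p : {mpoly R[i][n + n]}) :
    {mpoly R[i][n + n]} :=
  \sum_(j < n) dz j (dz j p).

Lemma calL_is_linear (R : realType) (n : nat) : linear (@calL R n).
Proof.
move=> c p q; rewrite /calL scaler_sumr -big_split /=.
by apply: eq_bigr => j _; rewrite !linearP.
Qed.

HB.instance Definition _ (R : realType) (n : nat) :=
  GRing.isLinear.Build R[i] {mpoly R[i][n + n]} {mpoly R[i][n + n]} _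
    (@calL R n) (@calL_is_linear R n).

Lemma mderiv_homog (K : nzRingType) (m d : nat) (i : 'I_m) (p : {mpoly K[m]}) :
  p \is d.-homog -> p^`M(i) \is d.-1.-homog.
Proof.
move=> hp; rewrite [p]mpolyE raddf_sum /= big_seq; apply: rpred_sum => u up.
rewrite mderivZ mderivX; apply/rpredZ.
have [->|u0] := posnP (u i); first by rewrite scale0r rpred0.
have uK : (u - U_(i) + U_(i))%MM = u.
  by apply/submK/mnm_lepP => l; rewrite mnm1E; case: eqP => // <-.
have: mdeg u = d := dhomog_mf hp up; rewrite -{1}uK mdegD mdeg1 addn1 => <-.
by apply/rpredZ; rewrite dhomogX.
Qed.

Lemma calL_homog (R : realType) (n k : nat) (p : {mpoly R[i][n + n]}) :
  p \is k.-homog -> calL p \is (k - 2).-homog.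
Proof.
have dzH d j q : q \is d.-homog -> @dz R n j q \is d.-1.-homog.
  by move=> hq; rewrite rpredD ?rpredZ ?mderiv_homog.
move=> hp; rewrite subn2; apply: rpred_sum => j _.
by apply: (dzH); apply: (dzH).
Qed.

(* The library makes dhomog m K k a vectType only for m a successor. *)
Definition calP (R : realType) (n k : nat) : Type := dhomog (n + n) R[i] k.

HB.instance Definition _ (R : realType) (n k : nat) :=
  GRing.Lmodule.on (calP R n k).

Definition dim_dhomog (m k : nat) : nat :=
  if m is m'.+1 then 'C(k + m', k) else (k == 0)%N.

Lemma dhomog_vector_axiom (K : nzRingType) (m k : nat) :
  Vector.axiom (dim_dhomog m k) (dhomog m K k).
Proof.
case: m => [|m]; last exact: dhomog_vecaxiom.
case: k => [|k] /=.
  exists (fun p : dhomog 0 K 0 => \row_(i < 1) (val p)@_0%MM) => [c p q|].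
    by apply/rowP => i; rewrite !mxE mcoeffD mcoeffZ.
  have hC (r : 'rV[K]_1) : (r 0 0) *: 1 \is [in K[0], 0.-homog].
    by apply/rpredZ/dhomog1.
  exists (fun r => DHomog (hC r)) => [p|r].
    apply/val_inj/mpolyP => u /=.
    by rewrite mxE mcoeffZ mcoeff1 [u]nvar0_mnmE eqxx mulr1.
  by apply/rowP => i; rewrite mxE /= mcoeffZ mcoeff1 eqxx mulr1 ord1.
exists (fun=> 0) => [c p q|]; first by rewrite scaler0 addr0.
exists (fun=> 0) => [p|r]; last by apply/rowP => -[].
apply/val_inj/mpolyP => u /=; rewrite mcoeff0; apply/esym.
apply: (@dhomog_nemf_coeff _ _ mdeg k.+1); first exact: dhomog_is_dhomog.
by change (mdeg u != k.+1); rewrite [u]nvar0_mnmE mdeg0.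
Qed.

HB.instance Definition _ (R : realType) (n k : nat) :=
  Lmodule_hasFinDim.Build R[i] (calP R n k)
    (dhomog_vector_axiom R[i] (n + n) k).

Definition calL_calP (R : realType) (n k : nat) (p : calP R n k) :
    calP R n (k - 2) :=
  DHomog (calL_homog (dhomog_is_dhomog p)).

Lemma calL_calP_is_linear (R : realType) (n k : nat) :
  linear (@calL_calP R n k).
Proof. by move=> c p q; apply/val_inj; rewrite /= !linearP. Qed.

HB.instance Definition _ (R : realType) (n k : nat) :=
  GRing.isLinear.Build R[i] (calP R n k) (calP R n (k - 2)) _
    (@calL_calP R n k) (@calL_calP_is_linear R n k).

(* For k < 2 the codomain calP R n (k - 2) is the space of constants, and calL *)
(* vanishes on calP R n k; see mem_calH.                                       *)
Definition calH (R : realType) (n k : nat) : {vspace calP R n k} :=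
  lker (linfun (@calL_calP R n k)).

Lemma mem_calH (R : realType) (n k : nat) (p : calP R n k) :
  (p \in calH R n k) = (calL (mpoly_of_dhomog p) == 0).
Proof. by rewrite memv_ker lfunE. Qed.

(* Main.v *)
(** [calL] is onto from degree [k] to degree [k - 2] by induction on the degree
    in the variables other than [x_1]: integrating a monomial twice in [x_1]
    and applying [calL] returns it plus monomials of strictly larger exponent
    in [x_1]. Rank-nullity then gives the dimension of the kernel. *)
Require Import Defs.
From mathcomp Require Import all_boot all_order all_algebra.
From mathcomp Require Import complex mpoly.
From mathcomp Require Import reals.
From mathcomp Require Import zify.

Import Order.TTheory GRing.Theory Num.Theory.

Local Open Scope ring_scope.

Lemma dz_dzE (R : realType) (n : nat) (j : 'I_n) (p : {mpoly R[i][n + n]}) :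
  dz j (dz j p) = p^`M(lshift n j)^`M(lshift n j)
    + ('i *: p^`M(lshift n j)^`M(rshift n j)
       + ('i *: p^`M(rshift n j)^`M(lshift n j)
          - p^`M(rshift n j)^`M(rshift n j))).
Proof.
rewrite /dz !mderivD !mderivZ scalerDr scalerA -expr2 sqrCi scaleN1r.
by rewrite -!addrA; congr (_ + _); rewrite addrCA.
Qed.

Lemma mderiv_homog0 (K : nzRingType) (m : nat) (i : 'I_m) (p : {mpoly K[m]}) :
  p \is 0.-homog -> p^`M(i) = 0.
Proof.
move=> hp; rewrite [p]mpolyE raddf_sum big_seq big1 //= => u up.
have /eqP := dhomog_mf hp up; rewrite /= mdeg_eq0 => /eqP ->.
by rewrite mderivZ mderivX mnm0E scale0r scaler0.
Qed.

(** Below degree 2 every first partial derivative is constant, so all second derivatives vanish. *)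
Lemma calL_lt2 (R : realType) (n k : nat) (p : {mpoly R[i][n + n]}) :
  (k < 2)%N -> p \is k.-homog -> calL p = 0.
Proof.
move=> k2 hp; rewrite /calL big1 // => j _.
have hd i : p^`M(i) \is 0.-homog.
  by have := mderiv_homog i hp; case: k k2 {hp} => [|[]].
by rewrite dz_dzE !(mderiv_homog0 _ _ _ _ (hd _)) !scaler0 subrr !addr0.
Qed.

(** Any index [j] can take the place of 1 in the induction; having one forces [n] to be positive. *)
Lemma calL_onto_monomial (R : realType) (n : nat) (j : 'I_n)
    (m : 'X_{1..n + n}) :
  exists2 q : {mpoly R[i][n + n]},
    q \is (mdeg m).+2.-homog & calL q = 'X_[m].
Proof.
set o := lshift n j; move: {2}(mdeg m) (erefl (mdeg m)) => k mk; rewrite mk.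
pose im (p : {mpoly R[i][n + n]}) :=
  exists2 q : {mpoly R[i][n + n]}, q \is k.+2.-homog & calL q = p.
have im0 : im 0 by exists 0; rewrite ?rpred0 ?linear0.
have imD p q : im p -> im q -> im (p + q).
  by move=> [p' hp <-] [q' hq <-]; exists (p' + q'); rewrite ?rpredD ?linearD.
have imZ c p : im p -> im (c *: p).
  by move=> [p' hp <-]; exists (c *: p'); rewrite ?rpredZ ?linearZ.
have imN p : im p -> im (- p) by rewrite -scaleN1r; apply: imZ.
(* [d] strictly bounds [k - m o], the degree of [m] in the variables other than [o]. At [d = 0] the
   bound contradicts [m o <= mdeg m]. *)
have [d] : {d | (k < d + m o)%N} by exists k.+1; rewrite addSn ltnS leq_addr.
elim: d m mk => [|d IHd] m mk hd.
  by move: hd; rewrite ltnNge -mk mdegE (bigD1 o) //= leq_addr.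
set m2 := (m + U_(o) + U_(o))%MM; set q := 'X_[m2] : {mpoly R[i][n + n]}.
have dm2 : mdeg m2 = k.+2 by rewrite !mdegD !mdeg1 mk !addn1.
have hq : q \is k.+2.-homog by rewrite -dm2 dhomogX.
have qoo : q^`M(o)^`M(o) = ((m o).+2 * (m o).+1)%:R *: 'X_[m].
  rewrite mderivX mderivZ !addmK mderivX !mnmDE mnm1E eqxx !addn1.
  by rewrite addmK scalerA natrM.
(* At most one of the two derivatives lowers the exponent [m o + 2] of [o], so the result is a
   multiple of a monomial of degree [k] whose exponent at [o] is at least [m o + 1]: the induction
   hypothesis applies. *)
have qab a b : (a != o) || (b != o) -> im (q^`M(a)^`M(b)).
  move=> ab; rewrite mderivX mderivZ mderivX.
  (* A zero exponent makes the coefficient vanish; otherwise the truncated subtraction of monomials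
     is a genuine one. *)
  have [->|a0] := posnP (m2 a); first by rewrite scale0r.
  have [->|b0] := posnP ((m2 - U_(a))%MM b); first by rewrite scale0r scaler0.
  have aK : (m2 - U_(a) + U_(a))%MM = m2.
    by apply/submK/mnm_lepP => l; rewrite mnm1E; case: eqP => // <-.
  have bK : (m2 - U_(a) - U_(b) + U_(b))%MM = (m2 - U_(a))%MM.
    by apply/submK/mnm_lepP => l; rewrite mnm1E; case: eqP => // <-.
  apply/imZ/imZ/IHd.
    by have := dm2; rewrite -{1}aK -{1}bK !mdegD !mdeg1 !addn1 => -[].
  rewrite !mnmBE !mnmDE !mnm1E eqxx.
  by move: ab; case: (a == o); case: (b == o) => //=; lia.
have im_dz j' : j' != j -> im (dz j' (dz j' q)).
  move=> jj; have lo : lshift n j' != o by rewrite eq_lshift.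
  have ro : rshift n j' != o by rewrite eq_rlshift.
  rewrite dz_dzE; apply: (imD); first by apply: (qab); rewrite lo.
  apply: (imD); first by apply/imZ/qab; rewrite lo.
  by apply: (imD); [apply/imZ/qab; rewrite ro | apply/imN/qab; rewrite ro].
have ro : rshift n j != o by rewrite eq_rlshift.
have c0 : ((m o).+2 * (m o).+1)%:R != 0 :> R[i] by rewrite pnatr_eq0.
suff : im (q^`M(o)^`M(o)).
  rewrite qoo => /(imZ ((m o).+2 * (m o).+1)%:R^-1).
  by rewrite scalerA mulVf ?scale1r.
(* Solve [calL q] for its pure second derivative in [o]: every other term involves a variable
   different from [o], hence lies in the image by [qab]. *)
have -> : q^`M(o)^`M(o) = calL q
    - ('i *: q^`M(o)^`M(rshift n j) + ('i *: q^`M(rshift n j)^`M(o)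
       - q^`M(rshift n j)^`M(rshift n j))
       + \sum_(j' < n | j' != j) dz j' (dz j' q)).
  by rewrite /calL (bigD1 j) //= dz_dzE -[X in _ = X - _]addrA addrK.
apply: (imD); first by exists q.
apply: (imN); apply: (imD); last first.
  by elim/big_ind: _ => // j' jj; apply: im_dz.
apply: (imD); first by apply/imZ/qab; rewrite ro orbT.
by apply: (imD); [apply/imZ/qab; rewrite ro | apply/imN/qab; rewrite ro].
Qed.

(** By linearity it suffices to lift each monomial in the support of [p]; [1 < k] ensures that its
    degree [k - 2] rises to exactly [k]. *)
Lemma calL_calP_onto (R : realType) (n k : nat) :
  (0 < n)%N -> (1 < k)%N -> limg (linfun (@calL_calP R n k)) = fullv.
Proof.
move=> n0 k1; apply/vspaceP => -[p hp]; rewrite memvf.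
suff [q hq qp] : exists2 q : {mpoly R[i][n + n]}, q \is k.-homog & calL q = p.
  have -> : DHomog hp = linfun (@calL_calP R n k) (DHomog hq).
    by rewrite lfunE; apply/val_inj.
  by rewrite memv_img ?memvf.
rewrite [p]mpolyE big_seq; elim/big_ind: _ => [||u up].
- by exists 0; rewrite ?rpred0 ?linear0.
- by move=> _ _ [q hq <-] [q' hq' <-]; exists (q + q'); rewrite ?rpredD ?linearD.
have [q hq <-] := calL_onto_monomial R n (Ordinal n0) u.
exists (p@_u *: q); rewrite ?linearZ //; apply: rpredZ.
have uk : mdeg u = (k - 2)%N := dhomog_mf hp up.
by move: hq; rewrite uk -[_.+2]addn2 subnK.
Qed.

Lemma dim_calP (R : realType) (n k : nat) :
  (0 < n)%N -> \dim {: calP R n k} = 'C(2 * n + k - 1, 2 * n - 1).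
Proof.
case: n => // n _; rewrite dimvf.
(* The left side is [dim_dhomog] computed at the successor [(n + n.+1).+1]; symmetry of binomials
   gives the right side. *)
change ('C(k + (n + n.+1), k) = 'C(2 * n.+1 + k - 1, 2 * n.+1 - 1)).
by rewrite -bin_sub ?leq_addr //; congr 'C(_, _); lia.
Qed.

Theorem theorem5p2 (R : realType) (n : nat) (hn : (1 <= n)%N) :
  [/\ forall k : nat, (2 <= k)%N ->
        (\dim (calH R n k))%:Z =
          'C(2 * n + k - 1, 2 * n - 1)%:Z - 'C(2 * n + k - 3, 2 * n - 1)%:Z,
      \dim (calH R n 0) = 1%N
    & \dim (calH R n 1) = (2 * n)%N].
Proof.
(* In degrees 0 and 1 the kernel is the whole space. *)
have H_lt2 k : (k < 2)%N -> \dim (calH R n k) = 'C(2 * n + k - 1, 2 * n - 1).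
  move=> k2; rewrite -(dim_calP R) //; congr (\dim _).
  apply/vspaceP => p.
  by rewrite memvf mem_calH (calL_lt2 _ _ k) ?eqxx ?dhomog_is_dhomog.
split=> [k k2||]; last 2 first.
- by rewrite H_lt2 // addn0 binn.
- rewrite H_lt2 // addnK; case: n hn {H_lt2} => // n _.
  by rewrite mulnS add2n subn1 binSn.
(* Rank-nullity, with image all of [calP R n (k - 2)]; since [2 <= k] and [1 <= n], no natural
   subtraction truncates. *)
have := limg_ker_dim (linfun (@calL_calP R n k)) fullv.
rewrite capfv calL_calP_onto // !dim_calP // => <-.
by rewrite PoszD (_ : (2 * n + (k - 2) - 1 = 2 * n + k - 3)%N) ?addrK //; lia.
Qed.
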